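(* Let $P$ be the probability distribution on $\mathbb R$ with probability density function $f(x)=\frac25$ for $0\le x\le\frac12$, $f(x)=\frac85$ for $\frac12<x\le1$, and $f(x)=0$ otherwise. Then there is a unique optimal set of three-means for $P$; with elements given as decimal approximations (each within $10^{-6}$) it is $\{0.200339,\,0.601018,\,0.867006\}$, and the quantization error is $V_3(P)=0.00739237$ (decimal approximation, i.e. $|V_3(P)-0.00739237|<10^{-8}$).
   Context: For a Borel probability measure $P$ on $\mathbb R$ and $n\ge1$, the $n$th quantization error is $V_n(P)=\inf\{\int \min_{a\in\alpha}(x-a)^2\,dP(x):\alpha\subset\mathbb R,\ \mathrm{card}(\alpha)\le n\}$. A set $\alpha$ with $\mathrm{card}(\alpha)\le n$ attaining the infimum is called an optimal set of $n$-means; for absolutely continuous $P$ it has exactly $n$ elements. *)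

(* Defs.v *)
From HB Require Import structures.
From mathcomp Require Import all_boot all_order all_algebra finmap lra.
From mathcomp Require Import all_classical all_reals all_analysis measurable_realfun.

Set Implicit Arguments.
Unset Strict Implicit.
Unset Printing Implicit Defensive.

Import Order.TTheory GRing.Theory Num.Theory.
Import numFieldNormedType.Exports.

Local Open Scope classical_set_scope.
Local Open Scope ring_scope.

(* The minimum over the empty set is +oo, so the empty set never attains a
   finite quantization error. *)
Definition distortion (R : realType) (P : probability (measurableTypeR R) R)
    (alpha : {fset R}) : \bar R :=
  (\int[P]_x \big[Order.min/+oo]_(a <- alpha) ((x - a) ^+ 2)%:E)%E.

Definition quantization_error (R : realType)
    (P : probability (measurableTypeR R) R) (n : nat) : \bar R :=
  ereal_inf [set distortion P alpha | alpha in
    [set alpha : {fset R} | (#|` alpha| <= n)%N]].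

Definition optimal_means (R : realType)
    (P : probability (measurableTypeR R) R) (n : nat) (alpha : {fset R}) : Prop :=
  (#|` alpha| <= n)%N /\ distortion P alpha = quantization_error P n.

Definition step_pdf (R : realType) (x : R) : R :=
  if (0 <= x <= 1 / 2) then 2 / 5
  else if (1 / 2 < x <= 1) then 8 / 5 else 0.

Definition step_prob (R : realType) : set (measurableTypeR R) -> \bar R :=
  fun A => (\int[lebesgue_measure]_(x in A) (step_pdf x)%:E)%E.

Lemma step_pdf_ge0 (R : realType) (x : R) : 0 <= step_pdf x.
Proof. by rewrite /step_pdf; case: ifP => // _; case: ifP. Qed.

Lemma measurable_step_pdf (R : realType) :
  measurable_fun [set: R] (@step_pdf R).
Proof.
have mand (a b : R) : measurable_fun setT (fun x : R => a <= x <= b).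
  by apply: measurable_and => //; exact: measurable_fun_ler.
apply: measurable_fun_ifT => //.
apply: measurable_fun_ifT => //.
by apply: measurable_and => //; [exact: measurable_fun_ltr
|exact: measurable_fun_ler].
Qed.

Lemma step_prob0 (R : realType) : step_prob (R := R) set0 = 0%E.
Proof. by rewrite /step_prob integral_set0. Qed.

Lemma step_prob_ge0 (R : realType) (A : set (measurableTypeR R)) :
  (0 <= step_prob A)%E.
Proof.
by apply: integral_ge0 => x _; rewrite lee_fin step_pdf_ge0.
Qed.

Lemma step_prob_sigma_additive (R : realType) :
  semi_sigma_additive (@step_prob R).
Proof.
move=> /= F mF tF mUF; rewrite /step_prob; apply: cvg_toP.
  apply: ereal_nondecreasing_is_cvgn => m n mn.
  apply: lee_sum_nneg_natr => // k _ _; exact: step_prob_ge0.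
rewrite ge0_integral_bigcup//=.
- apply/measurable_funTS/measurableT_comp => //.
  exact: measurable_step_pdf.
- by move=> x _; rewrite lee_fin step_pdf_ge0.
Qed.

HB.instance Definition _ (R : realType) := isMeasure.Build _ _ _
  (@step_prob R) (@step_prob0 R) (@step_prob_ge0 R)
  (@step_prob_sigma_additive R).

Lemma step_prob_setT (R : realType) : step_prob [set: R] = 1%E.
Proof.
have -> : step_prob [set: R] = (\int[lebesgue_measure]_(x in [set: R])
    ((cst (2 / 5)%:E \_ `[0%R, (1 / 2)%R]) x +
     (cst (8 / 5)%:E \_ `](1 / 2)%R, 1%R]) x))%E.
  apply: eq_integral => x _; rewrite /step_pdf !patchE /= !mem_setE !in_itv /=.
  have [x12|x12] := leP x (1 / 2); first by rewrite andbT; case: ifP; rewrite ?adde0.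
  by rewrite andbF /= add0e; case: ifP.
have mcst (i : interval R) (c : R) :
    measurable_fun setT (cst c%:E \_ [set` i]).
  by apply/(measurable_restrictT _ _).1.
have ge0cst (i : interval R) (c x : R) : 0 <= c ->
    (0 <= (cst c%:E \_ [set` i]) x)%E.
  by move=> c0; apply: erestrict_ge0 => y _; rewrite lee_fin.
rewrite ge0_integralD//; [|by move=> x _; exact: ge0cst|exact: mcst
  |by move=> x _; exact: ge0cst|exact: mcst].
rewrite -!integral_mkcond !integral_cst //= !lebesgue_measure_itv /= !lte_fin.
rewrite ifT; last by lra.
rewrite ifT; last by lra.
by rewrite -!EFinB -!EFinM -EFinD; congr EFin; lra.
Qed.

HB.instance Definition _ (R : realType) := @Measure_isProbability.Build _ _ R
  (@step_prob R) (@step_prob_setT R).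

(* Main.v *)
Require Import Defs.
From HB Require Import structures.
From mathcomp Require Import all_boot all_order all_algebra finmap ring lra.
From mathcomp Require Import all_classical all_reals all_analysis measurable_realfun.
Import Order.TTheory GRing.Theory Num.Theory.
Import numFieldNormedType.Exports.
Local Open Scope ring_scope.

(** Three means [a <= b <= c] cut [0, 1] at the midpoints [s <= t] of consecutive
    means, and their distortion is the sum of the costs of the three cells. If
    both cuts lie in the same half of [0, 1], or if [b] is close to [0] or [1],
    then crude bounds on the two halves exceed the optimum. Otherwise fix [b]:
    the part of the cost to the left of [1 / 2] only depends on [a] and [s], the
    part to the right only on [c] and [t], and both can be minimized by hand,
    even without the constraint that [s] and [t] are midpoints. What remains is
    a cubic in [b] whose excess over its least value is
    [16 / 45 * (b - b0) ^+ 2 * (b - b1)] with [b0 = (19 + sqrt 97) / 48] and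
    [b1 = (19 - 2 * sqrt 97) / 48 < 0]. *)

(** * Cell costs and integrals over intervals *)

Definition cell_cost (R : realType) (a u v : R) : R :=
  ((v - a) ^+ 3 - (u - a) ^+ 3) / 3.

(** The primitive is [(x - a) ^+ 3 / 3]. Prescribing [g] on the open interval only is enough, since
    the endpoints form a null set. *)
Lemma integral_sqr_itv (R : realType) (g : measurableTypeR R -> \bar R) (a u v : R) :
  measurable_fun [set: R] g -> u <= v ->
  (forall x, u < x < v -> g x = ((x - a) ^+ 2)%:E) ->
  (\int[lebesgue_measure]_(x in `[u, v]) g x = (cell_cost R a u v)%:E)%E.
Proof.
move=> mg; rewrite le_eqVlt => /predU1P[<- _|uv gE].
  by rewrite set_itv1 integral_set1 /cell_cost subrr mul0r.
pose F (x : R) : R := (x - a) ^+ 3 / 3.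
have dF (x : R) : is_derive x 1 F ((x - a) ^+ 2).
  by apply: is_derive_eq; rewrite /GRing.scale /=; field.
have cF : continuous F.
  by move=> x; apply: differentiable_continuous; apply/derivable1_diffP; case: (dF x).
have cf : continuous (fun x : R => (x - a) ^+ 2).
  by move=> y; apply: differentiable_continuous; apply/derivable1_diffP; exact: ex_derive.
transitivity (\int[lebesgue_measure]_(x in `[u, v]) ((x - a) ^+ 2)%:E)%E.
  rewrite [LHS]integral_itv_bndoo; last exact: measurable_funTS.
  rewrite [RHS]integral_itv_bndoo.
    by apply: eq_integral => x; rewrite inE /= in_itv /= => /gE.
  by apply: measurable_funTS; apply/measurable_EFinP; exact: continuous_measurable_fun.
rewrite (@continuous_FTC2 _ (fun x => (x - a) ^+ 2) F) //.
- by rewrite -EFinB /cell_cost /F; congr EFin; field.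
- exact: continuous_subspaceT.
- split => [y _||]; first by case: (dF y).
  + exact/cvg_at_right_filter/cF.
  + exact/cvg_at_left_filter/cF.
- by move=> y _; rewrite derive1E; case: (dF y).
Qed.

Lemma ge0_integral_itv_split (R : realType) (g : measurableTypeR R -> \bar R) (u v w : R) :
  measurable_fun [set: R] g -> (forall x, (0 <= g x)%E) -> u <= v -> v <= w ->
  (\int[lebesgue_measure]_(x in `[u, w]) g x =
   \int[lebesgue_measure]_(x in `[u, v]) g x +
   \int[lebesgue_measure]_(x in `[v, w]) g x)%E.
Proof.
move=> mg g0 uv vw.
have -> : `[u, w]%classic = (`[u, v] `|` `]v, w])%classic.
  by rewrite -itv_bndbnd_setU //= bnd_simp.
rewrite ge0_integral_setU //=.
- by congr (_ + _)%E; rewrite integral_itv_obnd_cbnd //; exact: measurable_funTS.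
- exact: measurable_funTS.
- apply/disj_setPS => x [] /=; rewrite !in_itv /= => /andP[_ xv] /andP[vx _].
  by move: (le_lt_trans xv vx); rewrite ltxx.
Qed.

(** [step_prob] is the mixture, with weights [1 / 5] and [4 / 5], of the uniform laws on the two
    halves. *)
Lemma integral_step_prob (R : realType) (g : measurableTypeR R -> \bar R) :
  measurable_fun [set: R] g -> (forall x, (0 <= g x)%E) ->
  (\int[@step_prob R]_x g x =
   (2 / 5)%:E * \int[lebesgue_measure]_(x in `[0%R, (1 / 2)%R]) g x +
   (8 / 5)%:E * \int[lebesgue_measure]_(x in `[(1 / 2)%R, 1%R]) g x)%E.
Proof.
move=> mg g0.
have h0 : 0 < 1 / 2 :> R by lra.
have h1 : 1 / 2 < 1 :> R by lra.
have p1 : 0 <= 1 / 5 :> R by lra.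
have p4 : 0 <= 4 / 5 :> R by lra.
pose m1 := mscale (NngNum p1) (uniform_prob h0).
pose m2 := mscale (NngNum p4) (uniform_prob h1).
rewrite (eq_measure_integral (measure_add m1 m2)); last first.
  move=> A mA _.
  rewrite /= /measure_add /msum !big_ord_recl big_ord0 /= adde0 /m1 /m2 /mscale /=.
  rewrite /uniform_prob /step_prob.
  have mpdf (u v : R) : measurable_fun [set: measurableTypeR R]
      (fun x => (uniform_pdf u v x)%:E).
    by apply/measurable_EFinP; exact: measurable_uniform_pdf.
  have pdf0 (u v : R) (x : R) : u < v -> (0 <= (uniform_pdf u v x)%:E)%E.
    by move=> uv; rewrite lee_fin uniform_pdf_ge0.
  (* The two uniform densities both charge [1 / 2], where [step_pdf] is [2 / 5]. *)
  have mA' : measurable (A `\ (1 / 2 : R)) by exact: measurableD.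
  have mspdf : measurable_fun [set: measurableTypeR R] (fun x => (step_pdf x)%:E).
    by apply/measurable_EFinP; exact: measurable_step_pdf.
  have mpdfA u v : measurable_fun (A `\ (1 / 2 : R)) (fun x => (uniform_pdf u v x)%:E).
    exact: measurable_funTS (mpdf u v).
  rewrite -!(@integral_setD1 _ _ (1 / 2) A) //; first last.
  - exact: measurable_funTS.
  - exact: mpdfA.
  - exact: mpdfA.
  have e15 : (0 <= (1 / 5)%:E :> \bar R)%E by rewrite lee_fin.
  have e45 : (0 <= (4 / 5)%:E :> \bar R)%E by rewrite lee_fin.
  rewrite -!ge0_integralZl //; try by move=> x _; exact: pdf0.
  rewrite -ge0_integralD //; first last.
  - exact: measurable_funeM.
  - by move=> x _; rewrite mule_ge0 // pdf0.
  - exact: measurable_funeM.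
  - by move=> x _; rewrite mule_ge0 // pdf0.
  apply: eq_integral => x; rewrite inE /= => -[_ /eqP xh].
  rewrite -!EFinM -EFinD /step_pdf /uniform_pdf; congr EFin.
  case: (ltgtP x (1 / 2)) xh => // xh _.
    by rewrite ?(andbT, andbF) /=; case: ifP => _; field.
  by rewrite ?(andbT, andbF) /=; case: ifP => _; field.
rewrite ge0_integral_measure_add // !ge0_integral_mscale // !integral_uniform //=.
by rewrite !muleA -!EFinM; congr (_%:E * _ + _%:E * _)%E; field.
Qed.

(* By the parallel axis identity the excess is [(v - u) * (a - (u + v) / 2) ^+ 2]. *)
Lemma cell_cost_ge (R : realType) (a u v : R) : u <= v ->
  (v - u) ^+ 3 / 12 <= cell_cost R a u v.
Proof.
move=> uv; rewrite -subr_ge0.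
have -> : cell_cost R a u v - (v - u) ^+ 3 / 12 = (v - u) * (a - (u + v) / 2) ^+ 2.
  by rewrite /cell_cost; field.
by rewrite mulr_ge0 ?subr_ge0 ?sqr_ge0.
Qed.

Lemma cell_cost_ge0 (R : realType) (a u v : R) : u <= v -> 0 <= cell_cost R a u v.
Proof.
move=> uv; apply: le_trans (cell_cost_ge R a u v uv).
by rewrite divr_ge0 // exprn_ge0 // subr_ge0.
Qed.

(** Each cell costs at least its length cubed over 12, and two cubes of lengths with a given sum add
    up to least when [t] halves the interval. *)
Lemma cell_cost2_ge (R : realType) (b c s t u : R) : s <= t -> t <= u ->
  (u - s) ^+ 3 / 48 <= cell_cost R b s t + cell_cost R c t u.
Proof.
move=> st tu; apply: le_trans (lerD (cell_cost_ge R b s t st) (cell_cost_ge R c t u tu)).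
rewrite -subr_ge0.
have -> : (t - s) ^+ 3 / 12 + (u - t) ^+ 3 / 12 - (u - s) ^+ 3 / 48 =
  (u - s) * (2 * t - s - u) ^+ 2 / 16 by field.
by rewrite divr_ge0 // mulr_ge0 ?sqr_ge0 // subr_ge0 (le_trans st).
Qed.

(** * Minimizing the cost over means and cuts *)

(** The cuts are free variables. Truncating them at [1 / 2], where the density jumps, gives one
    formula for all their positions: a cell that misses a half degenerates there to a point of cost
    0. *)
Definition voronoi_cost (R : realType) (a b c s t : R) : R :=
  2 / 5 * (cell_cost R a 0 (Num.min s (1 / 2)) +
           cell_cost R b (Num.min s (1 / 2)) (Num.min t (1 / 2)) +
           cell_cost R c (Num.min t (1 / 2)) (1 / 2)) +
  8 / 5 * (cell_cost R a (1 / 2) (Num.max s (1 / 2)) +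
           cell_cost R b (Num.max s (1 / 2)) (Num.max t (1 / 2)) +
           cell_cost R c (Num.max t (1 / 2)) 1).

(** The larger root of [96 x^2 - 76 x + 11], the local minimum of the cubic in the middle mean. *)
Definition best_mean2 (R : realType) : R := (19 + Num.sqrt 97) / 48.

(* [1 / 108 + 16 / 45 * (x ^+ 3 - 19 / 16 * x ^+ 2 + 11 / 32 * x)] is the least
   cost when the middle mean is [x]; it has a critical point at [best_mean2]. *)
Definition best_cost (R : realType) : R :=
  1 / 108 + 16 / 45 * (best_mean2 R ^+ 2 * ((19 - 2 * Num.sqrt 97) / 48)).

(** The root enters [best_cost] with a factor of about [6 / 10 ^+ 4], so a width of [1 / 10 ^+ 5] is
    fine enough for eight decimals. *)
Lemma sqrt97_bounds (R : realType) :
  98 / 10 + 4885 / 10 ^+ 5 < Num.sqrt 97 :> R /\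
  Num.sqrt 97 < 98 / 10 + 4886 / 10 ^+ 5 :> R.
Proof.
have sq : Num.sqrt 97 * Num.sqrt 97 = 97 :> R by rewrite -expr2 sqr_sqrtr.
have s0 : 0 <= Num.sqrt 97 :> R by exact: sqrtr_ge0.
by split; nra.
Qed.

Lemma best_cost_bounds (R : realType) :
  `|best_cost R - (739 / 10 ^+ 5 + 237 / 10 ^+ 8)| < 1 / 10 ^+ 8.
Proof.
have [lo hi] := sqrt97_bounds R.
have sq : Num.sqrt 97 ^+ 2 = 97 :> R by rewrite sqr_sqrtr.
(* Reducing by the square makes the cost affine in the root, within reach of [lra]. *)
have -> : best_cost R = 1 / 108 + 16 / 45 * ((1330 - 194 * Num.sqrt 97) / 48 ^+ 3).
  rewrite /best_cost /best_mean2.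
  have -> : ((19 + Num.sqrt 97) / 48) ^+ 2 * ((19 - 2 * Num.sqrt 97) / 48) =
    (6859 - 2 * Num.sqrt 97 ^+ 2 * Num.sqrt 97 - 57 * Num.sqrt 97 ^+ 2) / 48 ^+ 3 :> R.
    by field.
  by rewrite sq; field.
rewrite ltr_norml; apply/andP; split; lra.
Qed.

Lemma best_cost_lt (R : realType) : best_cost R < 37 / 5000.
Proof. by have /ltr_normlP[_] := best_cost_bounds R; lra. Qed.

(** The mean [c] alone serves the right half, which costs at least [8 / 5 * (1 / 96) = 1 / 60]. *)
Lemma voronoi_cost_below (R : realType) (a b c s t : R) :
  0 <= s -> s <= t -> t <= 1 / 2 -> best_cost R < voronoi_cost R a b c s t.
Proof.
move=> s0 st th.
have := best_cost_lt R.
rewrite /voronoi_cost !min_l ?max_r ?(le_trans st) //.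
have := cell_cost_ge0 R a 0 s s0.
have := cell_cost_ge0 R b s t st.
have := cell_cost_ge0 R c t (1 / 2) th.
have : 1 / 2 <= 1 :> R by lra.
move=> /(cell_cost_ge R c).
have z x : cell_cost R x (1 / 2) (1 / 2) = 0.
  by rewrite /cell_cost subrr mul0r.
by rewrite !z; lra.
Qed.

(** The mean [a] alone serves the left half. Near [1 / 4] it is of no help on the right; closer to
    [1 / 2] or beyond, it is expensive on the left. *)
Lemma voronoi_cost_above (R : realType) (a b c s t : R) :
  1 / 2 <= s -> s <= t -> t <= 1 -> best_cost R < voronoi_cost R a b c s t.
Proof.
move=> hs st t1.
have := best_cost_lt R.
rewrite /voronoi_cost !min_r ?max_l ?(le_trans hs) //.
have left : cell_cost R a 0 (1 / 2) = 1 / 96 + 1 / 2 * (a - 1 / 4) ^+ 2.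
  by rewrite /cell_cost; field.
have z x : cell_cost R x (1 / 2) (1 / 2) = 0.
  by rewrite /cell_cost subrr mul0r.
have hu0 : 0 <= s - 1 / 2 by lra.
have := cell_cost2_ge R b c s t 1 st t1.
rewrite !z left.
set x2 := cell_cost R b s t; set x3 := cell_cost R c t 1.
have := cell_cost_ge0 R a (1 / 2) s hs.
have s1 : s <= 1 by lra.
have cube0 : 0 <= (1 - s) ^+ 3 by rewrite exprn_ge0 // subr_ge0.
case: (lerP a (3 / 8)) => [a38|a38].
  have sqa : (1 / 8) ^+ 2 <= (1 / 2 - a) ^+ 2 by rewrite lerXn2r ?nnegrE; lra.
  (* [1 / 384] is the value at [s = 1 / 2]: a mean this far left gains nothing by serving points
     beyond [1 / 2]. *)
  have : 1 / 384 <= cell_cost R a (1 / 2) s + (1 - s) ^+ 3 / 48.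
    rewrite -subr_ge0.
    have -> : cell_cost R a (1 / 2) s + (1 - s) ^+ 3 / 48 - 1 / 384 =
        (s - 1 / 2) * ((1 / 2 - a) ^+ 2 - 1 / 64) +
        (s - 1 / 2) ^+ 2 * ((1 / 2 - a) + 1 / 32) + 5 / 16 * (s - 1 / 2) ^+ 3.
      by rewrite /cell_cost; field.
    by rewrite !addr_ge0 ?mulr_ge0 ?exprn_ge0 //; lra.
  have := sqr_ge0 (a - 1 / 4); lra.
case: (lerP (1 / 2) a) => [ha|ah].
  have : 1 / 16 <= (a - 1 / 4) ^+ 2 by nra.
  lra.
have sqa : 1 / 64 <= (a - 1 / 4) ^+ 2 by nra.
have : 1 / 1200 <= cell_cost R a (1 / 2) s + (1 - s) ^+ 3 / 48.
  (* [1 / 600] is the least value for [a = 1 / 2], reached at [s = 3 / 5]; hence the square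
     below. *)
  apply: (@le_trans _ _ (1 / 600)); first by lra.
  rewrite -subr_ge0.
  have -> : cell_cost R a (1 / 2) s + (1 - s) ^+ 3 / 48 - 1 / 600 =
      (s - 3 / 5) ^+ 2 * (5 / 16 * (s - 1 / 2) + 3 / 32) +
      (s - 1 / 2) * (1 / 2 - a) ^+ 2 + (s - 1 / 2) ^+ 2 * (1 / 2 - a).
    by rewrite /cell_cost; field.
  by apply: addr_ge0; [apply: addr_ge0|]; apply: mulr_ge0; rewrite ?sqr_ge0 //; lra.
lra.
Qed.

Lemma voronoi_costE (R : realType) (a b c s t : R) :
  s <= 1 / 2 -> 1 / 2 <= t ->
  voronoi_cost R a b c s t =
    2 / 5 * (cell_cost R a 0 s + cell_cost R b s (1 / 2)) +
    8 / 5 * (cell_cost R b (1 / 2) t + cell_cost R c t 1).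
Proof.
move=> sh ht; rewrite /voronoi_cost (min_l sh) (min_r ht) (max_r sh) (max_l ht).
by rewrite /cell_cost; ring.
Qed.

(* On each side of the middle mean [b] the cost is least when the boundary of
   its cell is at one third of the way from [b] to the end of the support. *)
Lemma voronoi_cost_excess (R : realType) (a b c s t : R) :
  s <= 1 / 2 -> 1 / 2 <= t ->
  voronoi_cost R a b c s t = best_cost R +
    (2 / 5 * (s * (a - s / 2) ^+ 2) + 8 / 5 * ((1 - t) * (c - (t + 1) / 2) ^+ 2) +
     (s - 2 / 3 * b) ^+ 2 * (4 / 15 * b - s / 10) +
     4 * (((1 - t) - 2 / 3 * (1 - b)) ^+ 2 * (4 / 15 * (1 - b) - (1 - t) / 10)) +
     16 / 45 * ((b - best_mean2 R) ^+ 2 * (b - (19 - 2 * Num.sqrt 97) / 48))).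
Proof.
move=> sh ht; have sq : Num.sqrt 97 ^+ 2 = 97 :> R by rewrite sqr_sqrtr.
rewrite voronoi_costE // /best_cost /best_mean2 /cell_cost.
(* Keeping the square of the root visible lets [sq] turn the linear coefficient into [11 / 32]. *)
have -> : (b - (19 + Num.sqrt 97) / 48) ^+ 2 * (b - (19 - 2 * Num.sqrt 97) / 48) =
  b ^+ 3 - 19 / 16 * b ^+ 2 + (361 - Num.sqrt 97 ^+ 2) / 768 * b
  - ((19 + Num.sqrt 97) / 48) ^+ 2 * ((19 - 2 * Num.sqrt 97) / 48) by field.
by rewrite sq; field.
Qed.

Lemma voronoi_cost_straddle (R : realType) (a b c s t : R) :
  0 <= s -> s <= 1 / 2 -> 1 / 2 <= t -> t <= 1 ->
  best_cost R <= voronoi_cost R a b c s t /\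
  (voronoi_cost R a b c s t = best_cost R ->
   [/\ a = best_mean2 R / 3, b = best_mean2 R & c = (2 + best_mean2 R) / 3]).
Proof.
move=> s0 sh ht t1.
have cost := voronoi_costE R a b c s t sh ht.
have strict : best_cost R < voronoi_cost R a b c s t ->
    best_cost R <= voronoi_cost R a b c s t /\
    (voronoi_cost R a b c s t = best_cost R ->
     [/\ a = best_mean2 R / 3, b = best_mean2 R & c = (2 + best_mean2 R) / 3]).
  by move=> lt; split; [exact: ltW|move=> e; rewrite e ltxx in lt].
case: (lerP b (3 / 16)) => [b3|b3].
  apply: strict; rewrite cost; have := best_cost_lt R.
  have := cell_cost_ge0 R a 0 s s0; have := cell_cost_ge0 R b s (1 / 2) sh.
  have := cell_cost_ge R c t 1 t1.
  have sqb : (1 / 4) ^+ 2 <= (1 / 2 - b) ^+ 2 by rewrite lerXn2r ?nnegrE; lra.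
  (* [1 / 96] is the value at [t = 1 / 2], where [c] serves the right half alone; that half again
     costs at least [1 / 60]. *)
  have : 1 / 96 <= cell_cost R b (1 / 2) t + (1 - t) ^+ 3 / 12.
    rewrite -subr_ge0.
    have -> : cell_cost R b (1 / 2) t + (1 - t) ^+ 3 / 12 - 1 / 96 =
        (t - 1 / 2) * ((1 / 2 - b) ^+ 2 - 1 / 16) +
        (t - 1 / 2) ^+ 2 * ((1 / 2 - b) + 1 / 8) + 1 / 4 * (t - 1 / 2) ^+ 3.
      by rewrite /cell_cost; field.
    by rewrite !addr_ge0 ?mulr_ge0 ?exprn_ge0 //; lra.
  lra.
case: (lerP (13 / 16) b) => [b13|b13].
  apply: strict; rewrite cost; have := best_cost_lt R.
  have := cell_cost2_ge R b c (1 / 2) t 1 ht t1.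
  have := cell_cost_ge R a 0 s s0.
  have sqb : (1 / 4) ^+ 2 <= (b - 1 / 2) ^+ 2 by rewrite lerXn2r ?nnegrE; lra.
  (* Now the left half costs no less than with [a] alone, and each half contributes at least
     [1 / 240]. *)
  have : 1 / 96 <= cell_cost R b s (1 / 2) + s ^+ 3 / 12.
    rewrite -subr_ge0.
    have -> : cell_cost R b s (1 / 2) + s ^+ 3 / 12 - 1 / 96 =
        (1 / 2 - s) * ((b - 1 / 2) ^+ 2 - 1 / 16) +
        (1 / 2 - s) ^+ 2 * ((b - 1 / 2) + 1 / 8) + 1 / 4 * (1 / 2 - s) ^+ 3.
      by rewrite /cell_cost; field.
    by rewrite !addr_ge0 ?mulr_ge0 ?exprn_ge0 //; lra.
  lra.
have excess := voronoi_cost_excess R a b c s t sh ht.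
rewrite excess; clear cost strict excess.
set e1 := s * _; set e2 := (1 - t) * _; set e3 := _ * (_ - s / 10).
set e4 := _ * (_ - (1 - t) / 10); set e5 := _ ^+ 2 * (b - _).
(* The thresholds [3 / 16] and [13 / 16] for [b] are where these two factors vanish in the extreme
   cases [s = 1 / 2] and [t = 1 / 2]. *)
have p3 : 0 < 4 / 15 * b - s / 10 by lra.
have p4 : 0 < 4 / 15 * (1 - b) - (1 - t) / 10 by lra.
have p5 : 0 < b - (19 - 2 * Num.sqrt 97) / 48 by have [] := sqrt97_bounds R; lra.
have e1p : 0 <= e1 by rewrite mulr_ge0 ?sqr_ge0.
have e2p : 0 <= e2 by rewrite mulr_ge0 ?sqr_ge0 // subr_ge0.
have e3p : 0 <= e3 by rewrite mulr_ge0 ?sqr_ge0 // ltW.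
have e4p : 0 <= e4 by rewrite mulr_ge0 ?sqr_ge0 // ltW.
have e5p : 0 <= e5 by rewrite mulr_ge0 ?sqr_ge0 // ltW.
split; first lra.
move=> eq0.
have /eqP : e5 = 0 by lra.
rewrite mulf_eq0 (gt_eqF p5) orbF sqrf_eq0 subr_eq0 => /eqP bE.
have /eqP : e4 = 0 by lra.
rewrite mulf_eq0 (gt_eqF p4) orbF sqrf_eq0 subr_eq0 => /eqP tE.
have /eqP : e3 = 0 by lra.
rewrite mulf_eq0 (gt_eqF p3) orbF sqrf_eq0 subr_eq0 => /eqP sE.
(* With [b] and the cuts determined, the outer cells have positive length, so their means must be
   their midpoints. *)
have /eqP : e2 = 0 by lra.
rewrite mulf_eq0 sqrf_eq0 => /orP[/eqP|/eqP] c0; first by lra.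
have /eqP : e1 = 0 by lra.
rewrite mulf_eq0 sqrf_eq0 => /orP[/eqP|/eqP] a0; first by lra.
by split; lra.
Qed.

(** * From the distortion of a finite set to cell costs *)

(** The integrand of [distortion], put on sequences to allow induction on the list of means. *)
Definition min_sqdist (R : realType) (s : seq R) (x : R) : \bar R :=
  \big[Order.min/+oo%E]_(a <- s) ((x - a) ^+ 2)%:E.

Lemma measurable_min_sqdist (R : realType) (s : seq R) :
  measurable_fun [set: measurableTypeR R] (min_sqdist R s).
Proof.
elim: s => [|a s IH].
  rewrite (_ : min_sqdist R [::] = cst +oo%E); first exact: measurable_cst.
  by apply/funext => x; rewrite /min_sqdist big_nil.
rewrite (_ : min_sqdist R (a :: s) =
    fun x => Order.min ((x - a) ^+ 2)%:E (min_sqdist R s x)); last first.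
  by apply/funext => x; rewrite /min_sqdist big_cons.
apply: measurable_mine => //; apply/measurable_EFinP.
apply: continuous_measurable_fun => y.
by apply: differentiable_continuous; apply/derivable1_diffP; exact: ex_derive.
Qed.

Lemma min_sqdist_ge0 (R : realType) (s : seq R) (x : R) : (0 <= min_sqdist R s x)%E.
Proof.
rewrite /min_sqdist; elim/big_ind: _ => // [u v u0 v0|a _].
  by rewrite le_min u0.
by rewrite lee_fin sqr_ge0.
Qed.

Lemma min_sqdistE (R : realType) (s : seq R) (x a : R) : a \in s ->
  (forall b, b \in s -> (x - a) ^+ 2 <= (x - b) ^+ 2) ->
  min_sqdist R s x = ((x - a) ^+ 2)%:E.
Proof.
move=> as_ amin; apply: le_anti; apply/andP; split; rewrite /min_sqdist.
  elim: s as_ {amin} => // b s IH; rewrite inE big_cons ge_min => /predU1P[<-|/IH ->].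
    by rewrite lexx.
  by rewrite orbT.
elim: s {as_} amin => [_|b s IH amin]; first by rewrite big_nil leey.
rewrite big_cons le_min lee_fin amin ?mem_head //=.
by apply: IH => c cs; rewrite amin // inE cs orbT.
Qed.

Lemma integral_cells (R : realType) (g : measurableTypeR R -> \bar R)
    (a b c u s t v : R) :
  measurable_fun [set: R] g -> (forall x, (0 <= g x)%E) ->
  u <= s -> s <= t -> t <= v ->
  (forall x, u < x < s -> g x = ((x - a) ^+ 2)%:E) ->
  (forall x, s < x < t -> g x = ((x - b) ^+ 2)%:E) ->
  (forall x, t < x < v -> g x = ((x - c) ^+ 2)%:E) ->
  (\int[lebesgue_measure]_(x in `[u, v]) g x =
   (cell_cost R a u s + cell_cost R b s t + cell_cost R c t v)%:E)%E.
Proof.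
move=> mg g0 us st tv ga gb gc.
rewrite (ge0_integral_itv_split R g u t v) ?(le_trans us) //.
rewrite (ge0_integral_itv_split R g u s t) //.
rewrite (integral_sqr_itv R g a u s) // (integral_sqr_itv R g b s t) //.
by rewrite (integral_sqr_itv R g c t v).
Qed.

Lemma distortion_cells (R : realType) (alpha : {fset R}) (a b c s t : R) :
  0 <= s -> s <= t -> t <= 1 ->
  (forall x, 0 < x < s -> min_sqdist R alpha x = ((x - a) ^+ 2)%:E) ->
  (forall x, s < x < t -> min_sqdist R alpha x = ((x - b) ^+ 2)%:E) ->
  (forall x, t < x < 1 -> min_sqdist R alpha x = ((x - c) ^+ 2)%:E) ->
  distortion (@step_prob R) alpha = (voronoi_cost R a b c s t)%:E.
Proof.
move=> s0 st t1 ga gb gc.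
have mg := measurable_min_sqdist R alpha; have g0 := min_sqdist_ge0 R alpha.
rewrite /distortion (integral_step_prob R (min_sqdist R alpha)) //.
rewrite (integral_cells R _ a b c 0 (Num.min s (1 / 2)) (Num.min t (1 / 2)) (1 / 2)) //.
- rewrite (integral_cells R _ a b c (1 / 2) (Num.max s (1 / 2)) (Num.max t (1 / 2)) 1) //.
  + by rewrite le_max lexx orbT.
  + by rewrite ge_max !le_max st lexx orbT.
  + by rewrite ge_max t1 /=; lra.
  + move=> x /andP[hx]; rewrite lt_max [x < 1 / 2]ltNge (ltW hx) orbF => xs.
    by apply: ga; rewrite xs andbT; lra.
  + move=> x; rewrite lt_max gt_max => /andP[/andP[sx hx]].
    by rewrite [x < 1 / 2]ltNge (ltW hx) orbF => xt; apply: gb; rewrite sx.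
  + by move=> x; rewrite gt_max => /andP[/andP[tx _] x1]; apply: gc; rewrite tx.
- by rewrite le_min s0 /=; lra.
- by rewrite le_min !ge_min st lexx orbT.
- by rewrite ge_min lexx orbT.
- by move=> x; rewrite lt_min => /andP[x0 /andP[xs _]]; apply: ga; rewrite x0.
- move=> x; rewrite gt_min lt_min => /andP[sx /andP[xt xh]].
  by apply: gb; rewrite xt andbT; move: sx; rewrite [1 / 2 < x]ltNge (ltW xh) orbF.
- move=> x; rewrite gt_min => /andP[tx xh]; apply: gc; apply/andP; split; last lra.
  by move: tx; rewrite [1 / 2 < x]ltNge (ltW xh) orbF.
Qed.

(** Means are arbitrary reals, so a midpoint may fall outside [[0, 1]]; clamping it does not affect
    how it separates the points inside. *)
Lemma clamp_lt (R : realType) (m x : R) : 0 < x < 1 ->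
  (x < Num.max 0 (Num.min 1 m) -> x <= m) /\ (Num.max 0 (Num.min 1 m) < x -> m <= x).
Proof.
move=> /andP[x0 x1]; rewrite lt_max lt_min gt_max gt_min; split.
  by rewrite ltNge (ltW x0) => /andP[_ /ltW].
by rewrite [1 < x]ltNge (ltW x1) => /andP[_ /ltW].
Qed.

(** The cuts need only separate the points of []0, 1[] as the midpoints do, which fits both clamped
    and exact midpoints. *)
Lemma distortion_voronoi (R : realType) (a b c s t : R) :
  a <= b -> b <= c -> 0 <= s -> s <= t -> t <= 1 ->
  (forall x, 0 < x < 1 -> (x < s -> x <= (a + b) / 2) /\ (s < x -> (a + b) / 2 <= x)) ->
  (forall x, 0 < x < 1 -> (x < t -> x <= (b + c) / 2) /\ (t < x -> (b + c) / 2 <= x)) ->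
  distortion (@step_prob R) [fset a; b; c]%fset = (voronoi_cost R a b c s t)%:E.
Proof.
move=> ab bc s0 st t1 hs ht; apply: distortion_cells => // x /andP[x1 x2].
- have x01 : 0 < x < 1 by rewrite x1; lra.
  have [/(_ x2) xs _] := hs x x01.
  apply: min_sqdistE => [|d]; rewrite !inE ?eqxx //.
  by move=> /orP[/orP[]|] /eqP ->; nra.
- have x01 : 0 < x < 1 by apply/andP; split; lra.
  have [_ /(_ x1) xs] := hs x x01; have [/(_ x2) xt _] := ht x x01.
  apply: min_sqdistE => [|d]; rewrite !inE ?eqxx ?orbT //.
  by move=> /orP[/orP[]|] /eqP ->; nra.
- have x01 : 0 < x < 1 by apply/andP; split; lra.
  have [_ /(_ x1) xt] := ht x x01.
  apply: min_sqdistE => [|d]; rewrite !inE ?eqxx ?orbT //.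
  by move=> /orP[/orP[]|] /eqP ->; nra.
Qed.

Lemma distortion_ge (R : realType) (a b c : R) : a <= b -> b <= c ->
  ((best_cost R)%:E <= distortion (@step_prob R) [fset a; b; c]%fset)%E /\
  (distortion (@step_prob R) [fset a; b; c]%fset = (best_cost R)%:E ->
   [/\ a = best_mean2 R / 3, b = best_mean2 R & c = (2 + best_mean2 R) / 3]).
Proof.
move=> ab bc.
pose clamp m : R := Num.max 0 (Num.min 1 m).
have c0 m : 0 <= clamp m by rewrite le_max lexx.
have c1 m : clamp m <= 1 by rewrite ge_max ler01 ge_min lexx.
have st : clamp ((a + b) / 2) <= clamp ((b + c) / 2).
  rewrite ge_max !le_max lexx /= le_min !ge_min lexx /=.
  by apply/orP; right; apply/orP; right; lra.
rewrite (distortion_voronoi R a b c _ _ ab bc (c0 _) st (c1 _) (clamp_lt R _) (clamp_lt R _)).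
move: st (c0 ((a + b) / 2)) (c1 ((b + c) / 2)).
(* The origin of the cuts is forgotten: the lower bound holds for arbitrary ordered cuts in
   [[0, 1]]. *)
move: (clamp _) (clamp _) => t s st s0 t1; rewrite lee_fin.
have strict : best_cost R < voronoi_cost R a b c s t ->
    best_cost R <= voronoi_cost R a b c s t /\
    ((voronoi_cost R a b c s t)%:E = (best_cost R)%:E ->
     [/\ a = best_mean2 R / 3, b = best_mean2 R & c = (2 + best_mean2 R) / 3]).
  by move=> lt; split; [exact: ltW|move=> [e]; rewrite e ltxx in lt].
case: (lerP t (1 / 2)) => [th|/ltW ht]; first by apply: strict; exact: voronoi_cost_below.
case: (lerP s (1 / 2)) => [sh|/ltW hs]; last by apply: strict; exact: voronoi_cost_above.
by have [h1 h2] := voronoi_cost_straddle R a b c s t s0 sh ht t1; split=> // -[/h2].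
Qed.

(** * The optimal triple and its uniqueness *)

Lemma card_fset3_le (T : choiceType) (a b c : T) : (#|` [fset a; b; c]%fset| <= 3)%N.
Proof.
rewrite cardfsU cardfs2 cardfs1; apply: leq_trans (leq_subr _ _) _.
by case: (a != b).
Qed.

Lemma distortion_best (R : realType) :
  distortion (@step_prob R)
    [fset best_mean2 R / 3; best_mean2 R; (2 + best_mean2 R) / 3]%fset =
  (best_cost R)%:E.
Proof.
have [rlo rhi] := sqrt97_bounds R.
have [blo bhi] : 1 / 2 < best_mean2 R /\ best_mean2 R < 3 / 4.
  by rewrite /best_mean2; split; lra.
clear rlo rhi.
(* The two cuts are the exact midpoints of these means, and every term of the excess vanishes
   there. *)
rewrite (distortion_voronoi R _ _ _ (2 / 3 * best_mean2 R) ((1 + 2 * best_mean2 R) / 3));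
  [|lra|lra|lra|lra|lra| |].
- by rewrite voronoi_cost_excess; [congr EFin; field|lra|lra].
- by move=> x _; split; lra.
- by move=> x _; split; lra.
Qed.

(** Repeating means presents smaller sets as triples too, so [distortion_ge] covers every nonempty
    competitor. *)
Lemma fset_card_le3P (R : realType) (alpha : {fset R}) :
  alpha <> fset0 -> (#|` alpha| <= 3)%N ->
  exists a b c, [/\ a <= b, b <= c & alpha = [fset a; b; c]%fset].
Proof.
move=> alpha0; rewrite -(size_sort <=%R).
have mem_alpha x : (x \in alpha) = (x \in sort <=%R alpha) by rewrite mem_sort.
have := sort_le_sorted alpha.
case: (sort <=%R alpha) mem_alpha => [|a [|b [|c [|d s]]]] //= mem_alpha.
- by move=> _ _; case: alpha0; apply/fsetP => x; rewrite mem_alpha inE.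
- move=> _ _; exists a, a, a; split=> //; apply/fsetP => x.
  by rewrite mem_alpha !inE !orbb.
- rewrite andbT => ab _; exists a, a, b; split=> //; apply/fsetP => x.
  by rewrite mem_alpha !inE orbb.
- rewrite andbT => /andP[ab bc] _; exists a, b, c; split=> //; apply/fsetP => x.
  by rewrite mem_alpha !inE orbA.
Qed.

Lemma distortion_fset0 (R : realType) :
  distortion (@step_prob R) fset0 = +oo%E.
Proof.
rewrite /distortion; under eq_integral do rewrite big_nil.
by rewrite integral_cst // [X in (_ * X)%E](step_prob_setT R) mule1.
Qed.

Lemma quantization_error3 (R : realType) :
  quantization_error (@step_prob R) 3 = (best_cost R)%:E.
Proof.
apply/eqP; rewrite eq_le; apply/andP; split.
  apply: ereal_inf_lbound; eexists; last exact: distortion_best.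
  exact: card_fset3_le.
apply: le_ereal_inf_tmp => _ [alpha /= card_alpha <-].
have [->|/eqP alpha0] := eqVneq alpha fset0; first by rewrite distortion_fset0 leey.
have [a [b [c [ab bc ->]]]] := fset_card_le3P R alpha alpha0 card_alpha.
by have [] := distortion_ge R a b c ab bc.
Qed.

Theorem proposition4p4 (R : realType) :
  (exists a1 a2 a3 : R,
    [/\ unique (optimal_means (@step_prob R) 3) [fset a1; a2; a3]%fset,
        `|a1 - (200 / 10 ^+ 3 + 339 / 10 ^+ 6)| < 1 / 10 ^+ 6,
        `|a2 - (601 / 10 ^+ 3 + 18 / 10 ^+ 6)| < 1 / 10 ^+ 6 &
        `|a3 - (867 / 10 ^+ 3 + 6 / 10 ^+ 6)| < 1 / 10 ^+ 6]) /\
  (`|quantization_error (@step_prob R) 3 - (739 / 10 ^+ 5 + 237 / 10 ^+ 8)%:E|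
     < (1 / 10 ^+ 8)%:E)%E.
Proof.
split; last by rewrite quantization_error3 -EFinB /= lte_fin best_cost_bounds.
have [rlo rhi] := sqrt97_bounds R.
exists (best_mean2 R / 3), (best_mean2 R), ((2 + best_mean2 R) / 3).
split; last 3 first.
- by rewrite /best_mean2 ltr_norml; apply/andP; split; lra.
- by rewrite /best_mean2 ltr_norml; apply/andP; split; lra.
- by rewrite /best_mean2 ltr_norml; apply/andP; split; lra.
rewrite /optimal_means quantization_error3; split.
  by split; [exact: card_fset3_le|exact: distortion_best].
move=> alpha [card_alpha].
have [->|/eqP alpha0] := eqVneq alpha fset0; first by rewrite distortion_fset0.
have [a [b [c [ab bc ->]]]] := fset_card_le3P R alpha alpha0 card_alpha.
by have [_ opt] := distortion_ge R a b c ab bc; move=> /opt[-> -> ->].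
Qed.
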